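(* Let $\boldsymbol{S}=\{S_1,S_2\}\subset\mathbb{R}^{2\times2}$ be such that there exists a symmetric positive-definite matrix $P\in\mathbb{R}^{2\times2}$ with $P-S_k^TPS_k\ge0$ for $k=1,2$. If $\rho(S_1)<1$ and $\rho(S_2)<1$, then for every $\theta$-ergodic probability measure $\mathbb{P}$ on $\varSigma_2^+$ satisfying $$\mathbb{P}(\{(1,2,1,2,1,2,\dots),(2,1,2,1,2,1,\dots)\})=0,$$ $\boldsymbol{S}$ is stable driven by $\mathbb{P}$-a.e. $\sigma\in\varSigma_2^+$, i.e. $\|S_{\sigma_n}\cdots S_{\sigma_1}\|\to0$ as $n\to+\infty$ for $\mathbb{P}$-a.e. $\sigma$.
   Context: $\rho$ denotes spectral radius; for a symmetric matrix $A$, $A\ge0$ means $x^TAx\ge0$ for all $x$. $\varSigma_2^+=\{1,2\}^{\mathbb{N}}$ is the set of switching signals $\sigma=(\sigma_n)_{n\ge1}$ with the product topology and its Borel $\sigma$-field; $\theta:\varSigma_2^+\to\varSigma_2^+$ is the one-sided shift $(\sigma_n)_{n\ge1}\mapsto(\sigma_{n+1})_{n\ge1}$. A $\theta$-ergodic probability measure is a Borel probability measure that is $\theta$-invariant and ergodic. *)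

(* Defs.v *)
From HB Require Import structures.
From mathcomp Require Import all_boot all_order all_algebra.
From mathcomp Require Import all_classical all_reals all_analysis.
From mathcomp Require Import complex.
Set Implicit Arguments.
Unset Strict Implicit.
Unset Printing Implicit Defensive.

Import Order.TTheory GRing.Theory Num.Theory.
Import numFieldNormedType.Exports.
Local Open Scope classical_set_scope.
Local Open Scope ring_scope.

(* Eigenvalues are taken in the complex field R[i]; the supremum is over the
   finite, nonempty (for n > 0) set of their moduli. *)
Definition spectral_radius (R : realType) (n : nat) (A : 'M[R]_n) : R :=
  sup [set ComplexField.Normc.normc z | z in
        [set z : R[i] | eigenvalue (map_mx (real_complex R) A) z]].

Definition quad_form (R : realType) (n : nat) (A : 'M[R]_n) (x : 'cV[R]_n) : R :=
  (x^T *m A *m x) 0 0.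

Definition psd (R : realType) (n : nat) (A : 'M[R]_n) : Prop :=
  A^T = A /\ forall x : 'cV[R]_n, 0 <= quad_form A x.

Definition posdef (R : realType) (n : nat) (A : 'M[R]_n) : Prop :=
  A^T = A /\ forall x : 'cV[R]_n, x != 0 -> 0 < quad_form A x.

(* Switching signals: {1, 2}^N with the product of the discrete topologies.
   The symbols 1, 2 are the ordinals 0, 1 of 'I_2, and the entry sigma_n of a
   signal (n >= 1) is sigma n.-1. *)
Definition signal : Type := prod_topology (fun _ : nat => discrete_topology 'I_2).

HB.instance Definition _ := Topological.on signal.
HB.instance Definition _ := isPointed.Build signal (fun _ => ord0).

Definition borel_signal := g_sigma_algebraType (@open signal).

Definition signal_shift (s : signal) : signal := fun n => s n.+1.

Definition periodic_signal (a b : 'I_2) : signal := fun n => if odd n then b else a.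

Lemma signal_shift_continuous : continuous signal_shift.
Proof.
move=> s.
have /= H := @cvg_sup signal nat (fun i : nat => Topological.class
    (initial_topology (fun f : nat -> discrete_topology 'I_2 => f i)))
  (signal_shift @ s) (signal_shift s) (fmap_filter signal_shift (nbhs_filter s)).
apply H; clear H => i A [_ [[B oB <-] Bs sBA]].
have sub : signal_shift @^-1` (@^~ i @^-1` B) `<=` signal_shift @^-1` A.
  by move=> t Bt; exact: sBA.
refine (@filterS signal (nbhs s) (nbhs_filter s) _ _ sub _).
refine (@proj_continuous nat (fun=> discrete_topology 'I_2) i.+1 s B _).
exact: open_nbhs_nbhs.
Qed.

Lemma signal_shift_measurable :
  measurable_fun [set: borel_signal] (signal_shift : borel_signal -> borel_signal).
Proof.
apply: (@measurability _ _ borel_signal borel_signal _ _ (@open signal)) => //.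
move=> _ [B oB <-]; rewrite setTI; apply: sub_sigma_algebra.
by move/continuousP: signal_shift_continuous; exact.
Qed.

Definition shift_ergodic (R : realType) (P : probability borel_signal R) : Prop :=
  (forall A : set borel_signal, measurable A -> P (signal_shift @^-1` A) = P A) /\
  (forall A : set borel_signal, measurable A -> signal_shift @^-1` A = A ->
     P A = 0%E \/ P A = 1%E).

Fixpoint switched_product (R : realType) (m : nat) (S : 'I_2 -> 'M[R]_m)
    (s : signal) (n : nat) : 'M[R]_m :=
  if n is k.+1 then S (s k) *m switched_product S s k else 1%:M.

(* Main.v *)
(* In the norm x |-> sqrt (x^T P x) both matrices are contractions.  If some
   x <> 0 satisfied |A A x| = |x|, then x and A x would both lie in the kernel of
   the positive semidefinite matrix P - A^T P A: either they are independent, so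
   that A is an isometry and |det A| = 1, or x is an eigenvector of A with
   eigenvalue 1 or -1; both contradict rho(A) < 1.  Hence S_1 S_1 and S_2 S_2 are
   strict contractions, and the products along a signal tend to 0 as soon as the
   signal repeats a symbol infinitely often.  The remaining signals are eventually
   alternating: they are preimages of the 2-periodic orbit under iterates of the
   shift, hence form a null set by invariance. *)
Require Import Defs.
From mathcomp Require Import all_boot all_order all_algebra.
From mathcomp Require Import all_classical all_reals all_analysis.
From mathcomp Require Import complex ring lra.
Import Order.TTheory GRing.Theory Num.Theory.
Import numFieldNormedType.Exports.
Local Open Scope classical_set_scope.
Local Open Scope ring_scope.

(** * Spectral radius against determinant and real eigenvalues *)

Lemma char_poly_roots (F : closedFieldType) (n : nat) (A : 'M[F]_n) :
  {rs : seq F | char_poly A = \prod_(z <- rs) ('X - z%:P)}.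
Proof.
have [rs Ers] := closed_field_poly_normal (char_poly A).
by exists rs; rewrite [LHS]Ers (monicP (char_poly_monic A)) scale1r.
Qed.

Lemma normc_eigenvalue_le (R : realType) (n : nat) (A : 'M[R]_n) (z : R[i]) :
  eigenvalue (map_mx (real_complex R) A) z ->
  ComplexField.Normc.normc z <= spectral_radius A.
Proof.
move=> Az; apply: ub_le_sup; last by exists z.
have [rs Ers] := char_poly_roots _ _ (map_mx (real_complex R) A).
have n0 (w : R[i]) : 0 <= ComplexField.Normc.normc w.
  by case: w => a b; exact: sqrtr_ge0.
(* [sup] dominates its set only if that set is bounded; the sum of the moduli of all characteristic
   roots is a bound. *)
exists (\sum_(w <- rs) ComplexField.Normc.normc w) => _ [w /= Aw <-].
move: Aw; rewrite eigenvalue_root_char Ers root_prod_XsubC => wrs.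
by rewrite (big_rem w)//= lerDl sumr_ge0.
Qed.

Lemma normcN (R : rcfType) (z : R[i]) :
  ComplexField.Normc.normc (- z) = ComplexField.Normc.normc z.
Proof. by case: z => a b /=; rewrite !sqrrN. Qed.

(** Evaluating the characteristic polynomial at 0 gives the determinant up to sign, and the modulus
    discards the signs. *)
Lemma det_eigenvalues (R : realType) (n : nat) (A : 'M[R]_n) (rs : seq R[i]) :
  char_poly (map_mx (real_complex R) A) = \prod_(z <- rs) ('X - z%:P) ->
  `|\det A| = \prod_(z <- rs) ComplexField.Normc.normc z.
Proof.
move=> Ers; have := char_poly_det (map_mx (real_complex R) A).
rewrite Ers -horner_coef0 horner_prod det_map_mx.
move/(congr1 (@ComplexField.Normc.normc R)).
rewrite ComplexField.Normc.normcM.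
have -> : ComplexField.Normc.normc ((-1) ^+ n : R[i]) = 1.
  elim: n {A Ers} => [|k IH]; first by rewrite ComplexField.Normc.normc1.
  rewrite exprS ComplexField.Normc.normcM IH normcN.
  by rewrite ComplexField.Normc.normc1 mul1r.
rewrite mul1r [X in _ = X -> _]/= expr0n addr0 sqrtr_sqr => <-.
elim: {Ers} rs => [|z rs IH].
  by rewrite !big_nil ComplexField.Normc.normc1.
rewrite !big_cons ComplexField.Normc.normcM IH; congr (_ * _).
by rewrite hornerXsubC sub0r normcN.
Qed.

Lemma spectral_radius_lt1_det (R : realType) (n : nat) (A : 'M[R]_n.+1) :
  spectral_radius A < 1 -> `|\det A| < 1.
Proof.
move=> rA; have [rs Ers] := char_poly_roots _ _ (map_mx (real_complex R) A).
have rs1 z : z \in rs -> ComplexField.Normc.normc z < 1.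
  move=> zrs; apply: le_lt_trans rA; apply: normc_eigenvalue_le.
  by rewrite eigenvalue_root_char Ers root_prod_XsubC.
have n0 (w : R[i]) : 0 <= ComplexField.Normc.normc w.
  by case: w => a b; exact: sqrtr_ge0.
rewrite (det_eigenvalues _ _ _ _ Ers).
(* An empty product would equal 1; the size [n.+1] guarantees a root. *)
have : (0 < size rs)%N.
  have := size_char_poly (map_mx (real_complex R) A).
  by rewrite Ers size_prod_XsubC => -[->].
elim: rs rs1 {Ers} => [//|z [|w rs] IH] rs1 _.
  by rewrite big_seq1 rs1 ?mem_head.
rewrite big_cons mulr_ilt1 ?rs1 ?mem_head ?prodr_ge0//.
by apply: IH => // u urs; apply: rs1; rewrite inE urs orbT.
Qed.

Lemma real_eigenvector_le (R : realType) (n : nat) (A : 'M[R]_n)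
    (x : 'cV[R]_n) (l : R) :
  x != 0 -> A *m x = l *: x -> `|l| <= spectral_radius A.
Proof.
move=> x0 Ax.
(* [eigenvalue] concerns row vectors: the column [x] shows that [l%:M - A] is singular, which yields
   a row vector [v]. *)
have /det0P[v v0 vA] : \det (l%:M - A) == 0.
  apply: contraNT x0 => d0.
  have U : l%:M - A \in unitmx by rewrite unitmxE unitfE.
  by rewrite -(mulKmx U x) mulmxBl mul_scalar_mx Ax subrr mulmx0.
have <- : ComplexField.Normc.normc (real_complex R l) = `|l|.
  by rewrite /= expr0n addr0 sqrtr_sqr.
apply: normc_eigenvalue_le; apply/eigenvalueP.
exists (map_mx (real_complex R) v); last by rewrite map_mx_eq0.
rewrite -map_mxM -map_mxZ; congr map_mx; apply/esym/eqP.
by rewrite -subr_eq0 -mul_mx_scalar -mulmxBr vA.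
Qed.

(** * Quadratic forms and their kernels *)

Lemma quad_form_mul (R : realType) (n : nat) (P A : 'M[R]_n) (x : 'cV[R]_n) :
  quad_form P (A *m x) = quad_form (A^T *m P *m A) x.
Proof. by rewrite /quad_form trmx_mul !mulmxA. Qed.

Lemma quad_formB (R : realType) (n : nat) (P Q : 'M[R]_n) (x : 'cV[R]_n) :
  quad_form (P - Q) x = quad_form P x - quad_form Q x.
Proof. by rewrite /quad_form mulmxBr mulmxBl !mxE. Qed.

Lemma quad_formZ (R : realType) (n : nat) (P : 'M[R]_n) (a : R) (x : 'cV[R]_n) :
  quad_form P (a *: x) = a ^+ 2 * quad_form P x.
Proof.
by rewrite /quad_form -scalemxAr linearZ /= -!scalemxAl scalerA mxE expr2.
Qed.

(** Put y = K x. Along x - t y the form is t^2 q(y) - 2 t |y|^2, which is negative for small t > 0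
    unless y = 0. *)
Lemma psd_kernel (R : realType) (n : nat) (K : 'M[R]_n) (x : 'cV[R]_n) :
  psd K -> quad_form K x = 0 -> K *m x = 0.
Proof.
move=> [Ksym K0] Kx; move Ey: (K *m x) => y.
pose N := (y^T *m y) 0 0.
have NE : N = \sum_i y i 0 ^+ 2.
  by rewrite /N mxE; apply: eq_bigr => i _; rewrite mxE expr2.
have xKy : x^T *m K = y^T by rewrite -Ey trmx_mul Ksym.
have xy : (x^T *m y) 0 0 = 0 by rewrite -[RHS]Kx /quad_form -mulmxA Ey.
have expand t : quad_form K (x - t *: y) = t ^+ 2 * quad_form K y - 2 * t * N.
  have entry (a b c d : 'M[R]_1) : (a - t *: b - (t *: c - (t * t) *: d)) 0 0 =
      a 0 0 - t * b 0 0 - t * c 0 0 + t ^+ 2 * d 0 0.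
    by rewrite !mxE; ring.
  have trB : (x - t *: y)^T = x^T - t *: y^T.
    by apply/matrixP => i j; rewrite !mxE.
  rewrite /quad_form -mulmxA mulmxBr -scalemxAr Ey trB.
  rewrite !mulmxBl !mulmxBr -!scalemxAl -!scalemxAr scalerA entry xy.
  by rewrite !mulmxA xKy -/N; ring.
have Nge0 : 0 <= N by rewrite NE sumr_ge0 => // i _; exact: sqr_ge0.
have N0 : N = 0.
  apply: le_anti; rewrite Nge0 andbT leNgt; apply/negP => Npos.
  pose q := quad_form K y; have q0 : 0 <= q by exact: K0.
  have q1 : 0 < q + 1 by rewrite ltr_wpDl.
  (* The minimiser is t = N / q; the added 1 keeps the denominator positive when q = 0. *)
  have := K0 (x - (N / (q + 1)) *: y).
  have -> : quad_form K (x - (N / (q + 1)) *: y) = - (N / (q + 1)) ^+ 2 * (q + 2).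
    by rewrite expand -/q; field; rewrite gt_eqF.
  by rewrite leNgt mulNr oppr_lt0 mulr_gt0 ?exprn_gt0 ?divr_gt0 ?ltr_wpDl.
apply/colP => i; rewrite mxE; apply/eqP; rewrite -sqrf_eq0.
move/eqP: N0; rewrite NE psumr_eq0; last by move=> j _; exact: sqr_ge0.
by move=> /allP/(_ i (mem_index_enum _)).
Qed.

Lemma isometric_orbit (R : realType) (P A : 'M[R]_2) (x : 'cV[R]_2) :
  posdef P -> psd (P - A^T *m P *m A) -> spectral_radius A < 1 ->
  quad_form P (A *m (A *m x)) = quad_form P x -> x = 0.
Proof.
move=> [Psym Ppos] Kpsd rA; set K := P - A^T *m P *m A in Kpsd.
have KE z : quad_form K z = quad_form P z - quad_form P (A *m z).
  by rewrite quad_formB -quad_form_mul.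
move=> AAx; apply/eqP/negPn/negP => x0.
have := Kpsd.2 x; have := Kpsd.2 (A *m x); rewrite !KE AAx => Kx1 Kx2.
(* The values at x, A x, A A x do not increase and the outer two agree, so all three agree. *)
have EAx : quad_form P (A *m x) = quad_form P x by lra.
have Kx : K *m x = 0 by apply: psd_kernel => //; rewrite KE EAx subrr.
have KAx : K *m (A *m x) = 0.
  by apply: psd_kernel => //; rewrite KE AAx EAx subrr.
have Px := Ppos x x0.
pose M : 'M[R]_(2, 1 + 1) := row_mx x (A *m x).
(* If x and A x form a basis, [K] vanishes on it, hence P = A^T P A and det A ^ 2 = 1. *)
have [U|] := boolP (M \in unitmx).
  have KM : K *m M = 0 by rewrite /M mul_mx_row Kx KAx row_mx0.
  have K0 : K = 0 by rewrite -(mulmxK U K) KM mul0mx.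
  have P0 : \det P != 0.
    apply/negP => /det0P[v v0 vP]; have := Ppos v^T.
    rewrite /quad_form trmxK vP mul0mx mxE ltxx.
    by rewrite trmx_eq0 => /(_ v0).
  have /(congr1 determinant) : P = A^T *m P *m A.
    by apply/eqP; rewrite -subr_eq0 -/K K0.
  rewrite !det_mulmx det_tr => dE.
  have := spectral_radius_lt1_det _ _ _ rA.
  have : \det A ^+ 2 = 1 by apply: (mulIf P0); rewrite mul1r [RHS]dE; ring.
  rewrite -real_normK ?num_real// => /eqP; rewrite sqrp_eq1// => /eqP ->.
  by rewrite ltxx.
(* Otherwise the entries of [v] are the coefficients of a linear relation between x and A x. *)
rewrite unitmxE unitfE negbK -det_tr => /det0P[v v0 vM].
pose a := @lsubmx _ _ 1 1 v; pose b := @rsubmx _ _ 1 1 v.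
have vab : v = row_mx a b by rewrite hsubmxK.
have abx : a *m x^T + b *m (A *m x)^T = 0.
  by rewrite -mul_row_col -tr_row_mx -vab.
have {}abx : a 0 0 *: x + b 0 0 *: (A *m x) = 0.
  apply: trmx_inj; rewrite trmx0 -abx linearD !linearZ /=.
  by congr (_ + _); rewrite [X in _ = X *m _]mx11_scalar mul_scalar_mx.
have [b0|b0] := eqVneq (b 0 0) 0.
  move: abx; rewrite b0 scale0r addr0 => /eqP; rewrite scaler_eq0 (negPf x0) orbF.
  move=> /eqP a0; move/eqP: v0; apply; rewrite vab.
  by rewrite (mx11_scalar a) (mx11_scalar b) a0 b0 !raddf0 row_mx0.
pose l := - a 0 0 / b 0 0.
have Axl : A *m x = l *: x.
  apply: (scalerI b0); rewrite scalerA /l mulrC divfK// scaleNr.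
  by apply/eqP; rewrite -addr_eq0 addrC abx.
have := real_eigenvector_le _ _ _ _ _ x0 Axl.
move: EAx; rewrite Axl quad_formZ -[RHS]mul1r => /(mulIf (lt0r_neq0 Px)).
rewrite -real_normK ?num_real// => /eqP; rewrite sqrp_eq1// => /eqP ->.
by rewrite leNgt rA.
Qed.

(** * Comparison with the Euclidean norm in dimension two *)

Lemma quad_form2E (R : realType) (A : 'M[R]_2) (x : 'cV[R]_2) :
  quad_form A x = A 0 0 * x 0 0 ^+ 2 + (A 0 1 + A 1 0) * (x 0 0 * x 1 0)
                  + A 1 1 * x 1 0 ^+ 2.
Proof.
rewrite /quad_form mxE !big_ord_recl big_ord0 /= !mxE !big_ord_recl !big_ord0 /=.
have -> : lift (0 : 'I_2) (0 : 'I_1) = 1 by apply/val_inj.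
by rewrite !mxE; ring.
Qed.

Lemma posdef2_coercive (R : realType) (A : 'M[R]_2) : posdef A ->
  exists2 m : R, 0 < m &
    forall x : 'cV[R]_2, m * (x 0 0 ^+ 2 + x 1 0 ^+ 2) <= quad_form A x.
Proof.
move=> [Asym Apos].
pose a := A 0 0; pose b := A 0 1; pose c := A 1 1.
have Aq x : quad_form A x =
    a * x 0 0 ^+ 2 + 2 * b * (x 0 0 * x 1 0) + c * x 1 0 ^+ 2.
  rewrite quad_form2E -/a -/c -/b.
  have -> : A 1 0 = b by rewrite /b -[in RHS]Asym mxE.
  by ring.
have pos u v : (u != 0) || (v != 0) ->
    0 < a * u ^+ 2 + 2 * b * (u * v) + c * v ^+ 2.
  move=> uv; pose x : 'cV[R]_2 := \col_i (if i == 0 then u else v).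
  have := Apos x; rewrite Aq !mxE /=; apply.
  apply: contraTneq uv => x0; rewrite negb_or !negbK.
  move/colP: x0 => x0; have := x0 0; have := x0 1.
  by rewrite !mxE /= => -> ->; rewrite eqxx.
have a0 : 0 < a.
  by have := pos 1 0; rewrite oner_eq0 => /(_ isT); congr (_ < _); ring.
have c0 : 0 < c.
  by have := pos 0 1; rewrite oner_eq0 orbT => /(_ isT); congr (_ < _); ring.
have d0 : 0 < a * c - b ^+ 2.
  (* At the vector (-b, a) the form equals a times the determinant. *)
  have := pos (- b) a; rewrite (gt_eqF a0) orbT => /(_ isT).
  have -> : a * (- b) ^+ 2 + 2 * b * (- b * a) + c * a ^+ 2 = a * (a * c - b ^+ 2).
    by ring.
  by rewrite pmulr_rgt0.
have ac0 : 0 < a + c by exact: addr_gt0.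
(* The determinant over the trace bounds the smallest eigenvalue from below. *)
exists ((a * c - b ^+ 2) / (a + c)); first exact: divr_gt0.
move=> x; rewrite Aq; set u := x 0 0; set v := x 1 0.
rewrite mulrAC ler_pdivrMr// -subr_ge0.
(* By Cayley-Hamilton, tr(A) A - det(A) I = A^2, whose form at x is |A x|^2 because A is
   symmetric. *)
suff -> : (a * u ^+ 2 + 2 * b * (u * v) + c * v ^+ 2) * (a + c)
    - (a * c - b ^+ 2) * (u ^+ 2 + v ^+ 2)
    = (a * u + b * v) ^+ 2 + (b * u + c * v) ^+ 2.
  by rewrite addr_ge0 ?sqr_ge0.
by ring.
Qed.

Lemma quad_form2_le (R : realType) (A : 'M[R]_2) :
  exists2 M : R, 0 < M &
    forall x : 'cV[R]_2, quad_form A x <= M * (x 0 0 ^+ 2 + x 1 0 ^+ 2).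
Proof.
pose a := A 0 0; pose b := A 0 1 + A 1 0; pose c := A 1 1.
exists (1 + `|a| + `|b| + `|c|); first by rewrite !ltr_wpDr.
move=> x; rewrite quad_form2E -/a -/b -/c; set u := x 0 0; set v := x 1 0.
have ha : a * u ^+ 2 <= `|a| * u ^+ 2 by rewrite ler_wpM2r ?sqr_ge0 ?ler_norm.
have hc : c * v ^+ 2 <= `|c| * v ^+ 2 by rewrite ler_wpM2r ?sqr_ge0 ?ler_norm.
have hb : b * (u * v) <= `|b| * (u ^+ 2 + v ^+ 2).
  apply: (le_trans (ler_norm _)); rewrite normrM ler_wpM2l//.
  have := sqr_ge0 (u + v); have := sqr_ge0 (u - v).
  have := sqr_ge0 u; have := sqr_ge0 v.
  by rewrite ler_norml => *; apply/andP; split; nra.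
have := mulr_ge0 (normr_ge0 a) (sqr_ge0 v).
have := mulr_ge0 (normr_ge0 c) (sqr_ge0 u).
have := sqr_ge0 u; have := sqr_ge0 v.
by lra.
Qed.

Lemma square_contraction (R : realType) (P A : 'M[R]_2) :
  posdef P -> psd (P - A^T *m P *m A) -> spectral_radius A < 1 ->
  exists2 d : R, d < 1 &
    forall x, quad_form P (A *m (A *m x)) <= d * quad_form P x.
Proof.
move=> Ppos Apsd rA; set Q := P - (A *m A)^T *m P *m (A *m A).
have QE x : quad_form Q x = quad_form P x - quad_form P (A *m (A *m x)).
  by rewrite quad_formB -quad_form_mul mulmxA.
have mono x : quad_form P (A *m x) <= quad_form P x.
  by rewrite -subr_ge0 quad_form_mul -quad_formB; exact: Apsd.2.
have Qpos : posdef Q.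
  split; first by rewrite /Q linearB /= !trmx_mul trmxK Ppos.1 !mulmxA.
  move=> x x0; rewrite QE subr_gt0 lt_neqAle (le_trans (mono _))// andbT.
  by apply: contra x0 => /eqP/(isometric_orbit _ _ _ _ Ppos Apsd rA) ->.
have [m m0 Qm] := posdef2_coercive _ _ Qpos.
have [M M0 PM] := quad_form2_le _ P.
(* Since Q >= m |x|^2 and P <= M |x|^2, the loss Q is at least m / M times P. *)
exists (1 - m / M); first by rewrite ltrBlDr ltrDl divr_gt0.
move=> x; rewrite mulrBl mul1r lerBrDr addrC -lerBrDr -QE.
apply: le_trans (Qm x); rewrite mulrAC -mulrA ler_pM2l//.
by rewrite ler_pdivrMr// mulrC.
Qed.

(** * Decay of the products along one signal *)

(** If the limit l were positive, eventually d u_k < l; a contracting k beyond that point gives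
    u_(k+2) < l, although u decreases to l. *)
Lemma nonincreasing_frequent_contraction (R : realType) (u : nat -> R) (d : R) :
  nonincreasing_seq u -> (forall n, 0 <= u n) -> d < 1 ->
  (forall N, exists2 k, (N <= k)%N & u k.+2 <= d * u k) -> u @ \oo --> (0 : R).
Proof.
move=> umono u0 d1 freq.
have ucvg : cvgn u.
  by apply: nonincreasing_is_cvgn => //; exists 0 => _ [n _ <-].
have lim_ge0 : 0 <= limn u by apply: limr_ge => //; near=> n; exact: u0.
suff -> : 0 = limn u by exact: ucvg.
apply/le_anti; rewrite lim_ge0/= leNgt; apply/negP => l0.
have dl : d * limn u < limn u by rewrite gtr_pMl.
have : \forall n \near \oo, d * u n < limn u.
  by apply: (cvgr_lt (d * limn u)) => //; apply: cvgMr.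
move=> [N _ Nd]; have [k Nk] := freq N.
apply/negP; rewrite -ltNge (lt_le_trans (Nd _ Nk))//.
exact: nonincreasing_cvgn_ge.
Unshelve. all: by end_near.
Qed.

Lemma switched_product_cvg0 (R : realType) (S : 'I_2 -> 'M[R]_2) (P : 'M[R]_2)
    (s : signal) :
  posdef P -> (forall k, psd (P - (S k)^T *m P *m S k)) ->
  (forall k, spectral_radius (S k) < 1) ->
  (forall N, exists2 k, (N <= k)%N & s k = s k.+1) ->
  `|switched_product S s n| @[n --> \oo] --> (0 : R).
Proof.
move=> Ppos Spsd rS freq.
have P0 x : 0 <= quad_form P x.
  have [->|/Ppos.2/ltW//] := eqVneq x 0.
  by rewrite /quad_form mulmx0 mxE.
have mono k x : quad_form P (S k *m x) <= quad_form P x.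
  by rewrite -subr_ge0 quad_form_mul -quad_formB; exact: (Spsd k).2.
have [d d1 Sd] : exists2 d, d < 1 & forall k x,
    quad_form P (S k *m (S k *m x)) <= d * quad_form P x.
  have /choice[d dP] k : exists d, d < 1 /\ forall x,
      quad_form P (S k *m (S k *m x)) <= d * quad_form P x.
    by have [d] := square_contraction _ _ _ Ppos (Spsd k) (rS k); exists d.
  exists (Num.max (d 0) (d 1)); first by rewrite gt_max !(dP _).1.
  move=> k x; apply: (le_trans ((dP k).2 x)); rewrite ler_wpM2r// le_max.
  have [->|->] : k = 0 \/ k = 1.
    by case: k => [[|[|//]] ?]; [left|right]; apply/val_inj.
  - by rewrite lexx.
  - by rewrite lexx orbT.
have [m m0 Pm] := posdef2_coercive _ _ Ppos.
pose Phi n := switched_product S s n.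
(* A Lyapunov function for the whole product: the sum of the squared P-norms of its columns. *)
pose u n := \sum_j quad_form P (col j (Phi n)).
have colM (A B : 'M[R]_2) j : col j (A *m B) = A *m col j B.
  by rewrite !colE mulmxA.
have u0 : u @ \oo --> (0 : R).
  apply: (nonincreasing_frequent_contraction _ _ d) => //.
  - apply/nonincreasing_seqP => n; apply: ler_sum => j _.
    by rewrite /Phi /= colM; exact: mono.
  - by move=> n; apply: sumr_ge0.
  - move=> N; have [k Nk sk] := freq N; exists k => //.
    rewrite mulr_sumr; apply: ler_sum => j _.
    (* A repeated symbol applies the same matrix twice, so its square contracts each column. *)
    by rewrite /Phi /= -sk !colM; exact: Sd.
have entry n i j : m * Phi n i j ^+ 2 <= u n.
  have le_u : quad_form P (col j (Phi n)) <= u n.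
    by rewrite /u (bigD1 j)//= lerDl sumr_ge0.
  apply: le_trans le_u; apply: le_trans (Pm _); rewrite ler_pM2l// !mxE.
  have [->|->] : i = 0 \/ i = 1.
    by case: i => [[|[|//]] ?]; [left|right]; apply/val_inj.
  - by rewrite lerDl sqr_ge0.
  - by rewrite lerDr sqr_ge0.
apply/cvgr0Pnorm_lt => e e0.
have me0 : 0 < m * e ^+ 2 by rewrite mulr_gt0 ?exprn_gt0.
move/cvgr0Pnorm_lt/(_ _ me0): u0; apply: filterS => n un.
(* The matrix norm is the largest modulus of an entry, so the bound [entry] suffices. *)
rewrite normr_id [`|_|]/Num.Def.normr /= mx_normrE.
apply: bigmax_lt => // -[i j] _ /=.
rewrite -(ltr_pXn2r (n := 2)) ?nnegrE ?(ltW e0)// real_normK ?num_real//.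
rewrite -(ltr_pM2l m0) (le_lt_trans (entry n i j))//.
exact: le_lt_trans (ler_norm _) un.
Qed.

(** * Eventually alternating signals form a null set *)

Lemma iter_signal_shift (s : signal) (n k : nat) :
  iter n signal_shift s k = s (n + k)%N.
Proof. by elim: n k => [//|n IH] k; rewrite iterS /signal_shift IH addnS. Qed.

Lemma alternating_signal (s : signal) : (forall k, s k != s k.+1) ->
  s = periodic_signal ord0 ord_max \/ s = periodic_signal ord_max ord0.
Proof.
move=> alt.
have ord2 (i : 'I_2) : i = ord0 \/ i = ord_max.
  by case: i => [[|[|//]] ?]; [left|right]; apply/val_inj.
have [s0|s0] := ord2 (s 0%N); [left|right]; apply/funext; elim=> [//|k];
  have := alt k => /[swap] ->; rewrite /periodic_signal /=;
  by case: (odd k) => /=; case: (ord2 (s k.+1)) => ->.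
Qed.

(** A product of discrete spaces is Hausdorff, so finite sets are closed and hence Borel. *)
Lemma measurable_signal_finite (A : set borel_signal) :
  finite_set A -> measurable A.
Proof.
move=> finA; rewrite -[A]setCK; apply: measurableC; apply: sub_sigma_algebra.
apply: closed_openC; move: A finA; apply/(@accessible_finite_set_closed signal).
apply/hausdorff_accessible/hausdorff_product => n.
exact: discrete_hausdorff.
Qed.

Lemma preimage_iter_shift_null (R : realType) (mu : probability borel_signal R)
    (E : set borel_signal) (n : nat) :
  shift_ergodic mu -> measurable E -> mu E = 0%E ->
  measurable (iter n signal_shift @^-1` E : set borel_signal) /\
  mu (iter n signal_shift @^-1` E) = 0%E.
Proof.
move=> [inv _] mE E0; elim: n => [//|n [mn IH]].
(* The shift applied first is split off, so that invariance reduces level n + 1 to level n. *)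
have -> : iter n.+1 signal_shift @^-1` E =
    signal_shift @^-1` (iter n signal_shift @^-1` E).
  by apply/funext => s; rewrite /preimage/= -iterS iterSr.
split; last by rewrite inv.
rewrite -[X in measurable X]setTI.
exact: signal_shift_measurable.
Qed.

Theorem corollary5p3 (R : realType) (S : 'I_2 -> 'M[R]_2)
    (hP : exists P : 'M[R]_2,
        posdef P /\ forall k : 'I_2, psd (P - (S k)^T *m P *m S k))
    (hrho : forall k : 'I_2, spectral_radius (S k) < 1)
    (mu : probability borel_signal R)
    (hmu : shift_ergodic mu)
    (hper : mu [set periodic_signal ord0 ord_max; periodic_signal ord_max ord0] = 0%E) :
  {ae mu, forall s : borel_signal,
     `|switched_product S s n| @[n --> \oo] --> (0 : R)}.
Proof.
case: hP => P [Ppos Spsd].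
set E := [set _; _] in hper.
have mE : measurable (E : set borel_signal).
  by apply: measurable_signal_finite; rewrite /E; exact: finite_set2.
have null n := preimage_iter_shift_null _ _ _ n hmu mE hper.
apply: (@negligibleS _ _ _ mu (\bigcup_n (iter n signal_shift @^-1` E))); last first.
  apply: negligible_bigcup => n; exists (iter n signal_shift @^-1` E).
  by split => //; have [] := null n.
move=> s /= ncvg; apply: contrapT => nE; apply: ncvg.
apply: (switched_product_cvg0 _ _ P) => // N; apply: contrapT => nfreq.
(* Without a repetition from N on, the signal shifted N times alternates and so lies in [E]. *)
apply: nE; exists N => //=; apply: alternating_signal => k.
rewrite !iter_signal_shift addnS; apply/eqP => sk.
by apply: nfreq; exists (N + k)%N => //; exact: leq_addr.
Qed.
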